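(* Let $\mathcal T=\{T_1,\dots,T_m\}\subset\mathbb C^{d\times d}$ be a family of matrices that are all upper triangular or all lower triangular, with nonzero diagonal entries $(T_i)_{jj}=\lambda_j^{(i)}$, and with probability weights $p_1,\dots,p_m$. Let $\rho_\infty^{(j)}:=\prod_{i=1}^m|\lambda_j^{(i)}|^{p_i}$ and $J:=\arg\max_{1\le j\le d}\rho_\infty^{(j)}$. Assume $J=\{j^\star\}$, set $\rho_\infty:=\rho_\infty^{(j^\star)}$, and let $\kappa_r$ be the $r$-th cumulant of the random variable $Z^{(j^\star)}$ that takes the value $\log|\lambda_{j^\star}^{(i)}|$ with probability $p_i$. Then there is a constant $c>0$ such that, as $n\to\infty$, $$\mathbb E\bigl[\rho_n\bigr]=\rho_\infty\left(1+\frac{\kappa_2}{2n}+\frac{\kappa_3/6+\kappa_2^2/8}{n^2}+O(n^{-3})\right)+O(e^{-cn}),$$ $$n\operatorname{Var}(\rho_n)=\rho_\infty^2\left(\kappa_2+\frac{2\kappa_3+3\kappa_2^2}{2n}+O(n^{-2})\right)+O(n e^{-cn}).$$ In particular, the exponentially small terms are negligible compared with all powers of $n^{-1}$.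
   Context: $\mathbb P_{\mathcal T}$ assigns mass $p_i\ge 0$ to $T_i$, with $\sum_i p_i=1$. Let $(i_k)_{k\ge1}$ be i.i.d. random indices in $\{1,\dots,m\}$ with $\mathbb P(i_k=i)=p_i$. The random spectral radius of length $n$ is $\rho_n=\rho_n(\mathcal T,\mathbb P_{\mathcal T}):=\rho(T_{i_n}\cdots T_{i_1})^{1/n}$, where $\rho(\cdot)$ is the spectral radius. Cumulants $\kappa_r$ of $Z$ are defined by $\log\mathbb E[e^{tZ}]=\sum_{r\ge1}\kappa_r t^r/r!$. *)

(* Defs.v *)
From HB Require Import structures.
From mathcomp Require Import all_boot all_order all_algebra finmap.
From mathcomp Require Import complex.
From mathcomp Require Import all_classical all_reals all_analysis.

Set Implicit Arguments.
Unset Strict Implicit.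
Unset Printing Implicit Defensive.

Import Order.TTheory GRing.Theory Num.Theory.
Import numFieldNormedType.Exports.

Local Open Scope classical_set_scope.
Local Open Scope ring_scope.

(* The modulus of a complex number, as an element of R: the norm `|z| of
   mathcomp lives in R[i]. *)
Notation modulus := Normc.normc.

Definition spectral_radius (R : realType) (d : nat) (A : 'M[R[i]]_d) : R :=
  sup [set modulus a | a in [set a : R[i] | eigenvalue A a]].

(* Later factors are multiplied on the left.  Sequences are indexed from 0, so
   that [s k] plays the role of i_{k+1}. *)
Fixpoint left_product (R : realType) (m d : nat) (T : 'I_m -> 'M[R[i]]_d)
    (s : nat -> 'I_m) (n : nat) : 'M[R[i]]_d :=
  if n is k.+1 then T (s k) *m left_product T s k else 1%:M.

Definition random_spectral_radius (R : realType) (m d : nat)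
    (T : 'I_m -> 'M[R[i]]_d) (Omega : Type) (idx : nat -> Omega -> 'I_m)
    (n : nat) : Omega -> R :=
  fun w => spectral_radius (left_product T (idx ^~ w) n) `^ (n%:R)^-1.

(* The finite set I carries the discrete sigma-algebra. *)
Definition discrete_rv (disp : measure_display) (Omega : measurableType disp)
    (I : finType) (X : Omega -> I) : Prop :=
  forall A : set I, measurable (X @^-1` A).

Definition mutually_independent (R : realType) (disp : measure_display)
    (Omega : measurableType disp) (P : probability Omega R) (I : finType)
    (X : nat -> Omega -> I) : Prop :=
  forall (K : {fset nat}) (A : nat -> set I),
    P (\bigcap_(k in [set` K]) (X k @^-1` A k)) =
    (\prod_(k <- K) P (X k @^-1` A k))%E.

Definition iid_with_law (R : realType) (disp : measure_display)
    (Omega : measurableType disp) (P : probability Omega R) (I : finType)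
    (p : I -> R) (X : nat -> Omega -> I) : Prop :=
  [/\ forall k, discrete_rv (X k),
      forall k a, P (X k @^-1` [set a]) = (p a)%:E
    & mutually_independent P X].

(* log E[exp(t Z)] = \sum_(r >= 1) kappa_r t^r / r! for all t near 0; the value
   kappa 0 is irrelevant.  As [fine] sends +oo to 0, finiteness of the moment
   generating function is required separately. *)
Definition is_cumulant_sequence (R : realType) (disp : measure_display)
    (Omega : measurableType disp) (P : probability Omega R) (Z : Omega -> R)
    (kappa : nat -> R) : Prop :=
  \forall t \near (0 : R),
    (mmt_gen_fun P Z t \is a fin_num) /\
    (\sum_(1 <= r < N) kappa r * t ^+ r / r`!%:R) @[N --> \oo] -->
      ln (fine (mmt_gen_fun P Z t)).

Definition rho_infty (R : realType) (m d : nat) (T : 'I_m -> 'M[R[i]]_d)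
    (p : 'I_m -> R) (j : 'I_d) : R :=
  \prod_(i < m) modulus (T i j j) `^ p i.

Definition log_diag (R : realType) (m d : nat) (T : 'I_m -> 'M[R[i]]_d)
    (j : 'I_d) (i : 'I_m) : R :=
  ln (modulus (T i j j)).

(* Main.v *)
Require Import Defs.
From HB Require Import structures.
From mathcomp Require Import all_boot all_order all_algebra finmap.
From mathcomp Require Import complex.
From mathcomp Require Import all_classical all_reals all_analysis.
From mathcomp Require Import ring lra.

(* For triangular matrices the spectral radius of the product is the largest
   modulus of its diagonal entries, so rho_n is the maximum over j of the
   geometric means exp(S_j / n), where S_j is a sum of n i.i.d. copies of
   log |lambda_j|.  A Chernoff bound shows that some j <> jstar wins only with
   exponentially small probability; up to such an error the moments of rho_n
   are those of exp(S_jstar / n), the q-th being M(q/n)^n = exp(n log M(q/n)),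
   with M the moment generating function of Z = log |lambda_jstar|.  The
   cumulant series expands n log M(q/n) in powers of 1/n, and its first
   coefficient is the mean of Z, i.e. log rho_oo. *)

Set Implicit Arguments.
Unset Strict Implicit.
Unset Printing Implicit Defensive.

Import Order.TTheory GRing.Theory Num.Theory.
Import numFieldNormedType.Exports.

Local Open Scope classical_set_scope.
Local Open Scope ring_scope.

(** * Expectations over the first n indices as finite sums *)

Lemma expectation_discrete_rv (R : realType) (disp : measure_display)
    (Omega : measurableType disp) (P : probability Omega R) (I : finType)
    (X : Omega -> I) (f q : I -> R) :
  discrete_rv X -> (forall a, P (X @^-1` [set a]) = (q a)%:E) ->
  ('E_P[f \o X] = (\sum_a q a * f a)%:E)%E.
Proof.
move=> mX PX; rewrite unlock.
have intf a : P.-integrable setT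
    (fun w => (f a)%:E * (\1_(X @^-1` [set a]) w)%:E)%E.
  apply: integrableZl => //.
  by apply: integrable_indic.
under eq_integral => w _.
  have -> : ((f \o X) w)%:E =
      (\sum_a (f a)%:E * (\1_(X @^-1` [set a]) w)%:E)%E.
    rewrite (bigD1 (X w)) //= big1 ?adde0 => [|a neq_a].
      by rewrite indicE mem_set ?mule1.
    rewrite indicE memNset ?mule0 //= => eq_a.
    by rewrite eq_a eqxx in neq_a.
  over.
rewrite integral_sum // -sumEFin; apply: eq_bigr => a _.
rewrite integralZl //; last first.
  by apply: integrable_indic.
rewrite integral_indic // setIT.
by transitivity ((f a)%:E * P (X @^-1` [set a]))%E => //; rewrite PX -EFinM mulrC.
Qed.

(** Prescribing the first [n] indices is a cylinder event, and independence over a finite index set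
    turns its probability into a product. *)
Lemma prob_idx_prefix (R : realType) (m : nat) (p : 'I_m -> R)
    (disp : measure_display) (Omega : measurableType disp)
    (P : probability Omega R) (idx : nat -> Omega -> 'I_m)
    (idx_iid : iid_with_law P p idx) (n : nat) (s : {ffun 'I_n -> 'I_m}) :
  P ((fun w => [ffun k : 'I_n => idx k w]) @^-1` [set s]) =
    (\prod_(k < n) p (s k))%:E.
Proof.
have [_ Pidx indep] := idx_iid.
(* [mutually_independent] takes a family of events over all of [nat]; beyond [n] the event is chosen
   trivial. *)
pose A k : set 'I_m := if insub k is Some k' then [set s k'] else setT.
pose K := [fset k in iota 0 n]%fset.
have AE (k : 'I_n) : A k = [set s k] by rewrite /A valK.
have memK k : (k \in K) = (k < n)%N by rewrite inE /= mem_iota.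
have -> : (fun w => [ffun k : 'I_n => idx k w]) @^-1` [set s] =
    \bigcap_(k in [set` K]) (idx k @^-1` A k).
  apply/seteqP; split=> w /=.
    move=> eq_s k /=; rewrite memK => lt_kn.
    by have /= -> := AE (Ordinal lt_kn); rewrite -eq_s ffunE.
  move=> capA; apply/ffunP => k; rewrite ffunE.
  have := capA k; rewrite AE; apply; by rewrite /= memK.
rewrite indep (perm_big (iota 0 n)) /=; last first.
  by apply: uniq_perm; rewrite ?fset_uniq ?iota_uniq // => k; rewrite memK mem_iota.
rewrite -[in LHS](subn0 n) -/(index_iota 0 n) big_mkord -prodEFin.
by apply: eq_bigr => k _; rewrite AE Pidx.
Qed.

Lemma discrete_prefix (I : finType) (disp : measure_display)
    (Omega : measurableType disp) (idx : nat -> Omega -> I) (n : nat) :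
  (forall k, discrete_rv (idx k)) ->
  discrete_rv (fun w => [ffun k : 'I_n => idx k w]).
Proof.
move=> midx A.
have -> : (fun w => [ffun k : 'I_n => idx k w]) @^-1` A =
    \bigcup_(s in A) \bigcap_(k in [set: 'I_n]) (idx k @^-1` [set s k]).
  apply/seteqP; split=> [w Aw|w [s As sw]] /=.
    by exists [ffun k : 'I_n => idx k w] => // k _ /=; rewrite ffunE.
  suff -> : [ffun k : 'I_n => idx k w] = s by [].
  by apply/ffunP => k; rewrite ffunE; exact: sw.
apply: fin_bigcup_measurable => // s _.
by apply: fin_bigcap_measurable => // k _; exact: midx.
Qed.

Section iid_prefix.
Variables (R : realType) (m : nat) (p : 'I_m -> R).

(** This is the expectation under the [n]-fold product of the law [p]; later estimates work on this
    finite sum, away from the probability space. *)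
Definition prefix_mean (n : nat) (f : {ffun 'I_n -> 'I_m} -> R) : R :=
  \sum_(s : {ffun 'I_n -> 'I_m}) (\prod_(k < n) p (s k)) * f s.

Lemma expectation_prefix (disp : measure_display)
    (Omega : measurableType disp)
    (P : probability Omega R) (idx : nat -> Omega -> 'I_m)
    (idx_iid : iid_with_law P p idx) (n : nat) (f : {ffun 'I_n -> 'I_m} -> R) :
  ('E_P[fun w => f [ffun k : 'I_n => idx k w]] = (prefix_mean f)%:E)%E.
Proof.
apply: (@expectation_discrete_rv _ _ _ P _
  (fun w => [ffun k : 'I_n => idx k w]) f (fun s => \prod_(k < n) p (s k))).
  by apply: discrete_prefix => k; case: idx_iid.
by move=> s; exact: prob_idx_prefix.
Qed.

(** Independence in finite form: expanding the power of a sum yields one product per word [s]. *)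
Lemma prefix_mean_prod (n : nat) (g : 'I_m -> R) :
  prefix_mean (fun s : {ffun 'I_n -> 'I_m} => \prod_(k < n) g (s k)) =
  (\sum_i p i * g i) ^+ n.
Proof.
rewrite -[in RHS](card_ord n) -prodr_const /= bigA_distr_bigA.
by apply: eq_bigr => s _; rewrite big_split.
Qed.

Hypotheses (p_ge0 : forall i, 0 <= p i) (p_sum1 : \sum_(i < m) p i = 1).

Lemma prefix_mean_cst (n : nat) (a : R) :
  prefix_mean (fun _ : {ffun 'I_n -> 'I_m} => a) = a.
Proof.
rewrite /prefix_mean -mulr_suml.
have := prefix_mean_prod n (fun=> 1).
rewrite (eq_bigr p) => [|i _]; last by rewrite mulr1.
rewrite p_sum1 expr1n /prefix_mean => E.
rewrite (_ : \sum_(s : {ffun _ -> _}) _ = 1) ?mul1r // -[RHS]E.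
by apply: eq_bigr => s _; rewrite [X in _ * X]big1 ?mulr1.
Qed.

Lemma le_prefix_mean (n : nat) (f g : {ffun 'I_n -> 'I_m} -> R) :
  (forall s, f s <= g s) -> prefix_mean f <= prefix_mean g.
Proof.
move=> le_fg; apply: ler_sum => s _; apply: ler_wpM2l => //.
by apply: prodr_ge0.
Qed.

Lemma prefix_meanD (n : nat) (f g : {ffun 'I_n -> 'I_m} -> R) :
  prefix_mean (fun s => f s + g s) = prefix_mean f + prefix_mean g.
Proof. by rewrite -big_split; apply: eq_bigr => s _; rewrite mulrDr. Qed.

Lemma prefix_meanZ (n : nat) (a : R) (f : {ffun 'I_n -> 'I_m} -> R) :
  prefix_mean (fun s => a * f s) = a * prefix_mean f.
Proof. by rewrite /prefix_mean mulr_sumr; apply: eq_bigr => s _; rewrite mulrCA. Qed.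

Lemma prefix_mean_sum (n : nat) (I : finType)
    (f : I -> {ffun 'I_n -> 'I_m} -> R) :
  prefix_mean (fun s => \sum_i f i s) = \sum_i prefix_mean (f i).
Proof.
rewrite exchange_big /=; apply: eq_bigr => s _.
by rewrite mulr_sumr.
Qed.

Lemma variance_prefix (disp : measure_display)
    (Omega : measurableType disp)
    (P : probability Omega R) (idx : nat -> Omega -> 'I_m)
    (idx_iid : iid_with_law P p idx) (n : nat) (f : {ffun 'I_n -> 'I_m} -> R) :
  (variance P (fun w => f [ffun k : 'I_n => idx k w]) =
   (prefix_mean (fun s => f s ^+ 2) - prefix_mean f ^+ 2)%:E)%E.
Proof.
rewrite /variance unlock (expectation_prefix idx_iid) /=.
pose g s := (f s - prefix_mean f) ^+ 2.
rewrite (_ : (_ * _)%R = fun w => g [ffun k : 'I_n => idx k w]); last first.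
  by apply/funext.
rewrite (expectation_prefix idx_iid); congr (_%:E).
have -> : g = fun s => f s ^+ 2 + (- 2 * prefix_mean f * f s + prefix_mean f ^+ 2).
  by apply/funext => s; rewrite /g; ring.
rewrite !prefix_meanD prefix_meanZ prefix_mean_cst; ring.
Qed.

End iid_prefix.

(** * Spectral radius of products of triangular matrices *)

Lemma char_poly_tr (F : comNzRingType) (n : nat) (A : 'M[F]_n) :
  char_poly A^T = char_poly A.
Proof.
by rewrite /char_poly -[in RHS]det_tr /char_poly_mx linearB /= tr_scalar_mx map_trmx.
Qed.

(** [is_trig_mx] means lower triangular; the upper case reduces to it because transposition
    preserves the characteristic polynomial. *)
Lemma eigenvalue_trig (F : fieldType) (n : nat) (A : 'M[F]_n) (a : F) :
  is_trig_mx A^T \/ is_trig_mx A -> eigenvalue A a <-> exists j, a = A j j.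
Proof.
move=> trigA; have -> : eigenvalue A a = (\prod_(j < n) (a - A j j) == 0).
  rewrite eigenvalue_root_char rootE; case: trigA => trigA.
    rewrite -char_poly_tr char_poly_trig // horner_prod.
    by under eq_bigr do rewrite mxE hornerXsubC.
  rewrite char_poly_trig // horner_prod.
  by under eq_bigr do rewrite hornerXsubC.
split=> [/prodf_eq0[j _]|[j ->]]; first by rewrite subr_eq0 => /eqP; exists j.
by rewrite (bigD1 j) //= subrr mul0r.
Qed.

Lemma is_trig_mulmx (F : pzRingType) (n : nat) (A B : 'M[F]_n) :
  is_trig_mx A -> is_trig_mx B ->
  is_trig_mx (A *m B) /\ (forall j, (A *m B) j j = A j j * B j j).
Proof.
move=> /is_trig_mxP trigA /is_trig_mxP trigB; split=> [|j].
  apply/is_trig_mxP => i j lt_ij; rewrite mxE big1 // => k _.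
  have [lt_ik|le_ki] := ltnP i k; first by rewrite trigA // mul0r.
  by rewrite trigB ?mulr0 //; apply: leq_ltn_trans lt_ij.
rewrite mxE (bigD1 j) //= big1 ?addr0 // => k neq_kj.
have [lt_jk|le_kj] := ltnP j k; first by rewrite trigA // mul0r.
by rewrite trigB ?mulr0 // ltn_neqAle neq_kj.
Qed.

Lemma left_product_trig (R : realType) (m d : nat) (T : 'I_m -> 'M[R[i]]_d)
    (T_trig : (forall i, is_trig_mx (T i)^T) \/ (forall i, is_trig_mx (T i)))
    (s : nat -> 'I_m) (n : nat) :
  let A := left_product T s n in
  (is_trig_mx A^T \/ is_trig_mx A) /\
  (forall j, A j j = \prod_(k < n) T (s k) j j).
Proof.
case: T_trig => trigT.
  suff: is_trig_mx (left_product T s n)^T /\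
      (forall j, left_product T s n j j = \prod_(k < n) T (s k) j j).
    by move=> [? ?]; split => //; left.
  elim: n => [|n [IHt IHd]] /=.
    by rewrite trmx1 scalar_mx_is_trig; split=> // j; rewrite big_ord0 mxE eqxx.
  (* Transposition reverses products, so the new factor now stands on the right. *)
  have [trigA diagA] := is_trig_mulmx IHt (trigT (s n)).
  rewrite trmx_mul; split=> // j; rewrite big_ord_recr /= -IHd.
  by have := diagA j; rewrite -trmx_mul !mxE => ->.
suff: is_trig_mx (left_product T s n) /\
    (forall j, left_product T s n j j = \prod_(k < n) T (s k) j j).
  by move=> [? ?]; split => //; right.
elim: n => [|n [IHt IHd]] /=.
  by rewrite scalar_mx_is_trig; split=> // j; rewrite big_ord0 mxE eqxx.
have [trigA diagA] := is_trig_mulmx (trigT (s n)) IHt.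
by split=> // j; rewrite big_ord_recr /= -IHd diagA mulrC.
Qed.

(** The eigenvalues are the diagonal entries, so the supremum runs over a finite set; [0 < d] makes
    it nonempty, hence attained. *)
Lemma spectral_radius_trig (R : realType) (d : nat) (A : 'M[R[i]]_d) :
  (0 < d)%N -> is_trig_mx A^T \/ is_trig_mx A ->
  (forall j, modulus (A j j) <= spectral_radius A) /\
  (exists j, spectral_radius A = modulus (A j j)).
Proof.
case: d A => // d A _ trigA.
pose j0 := [arg max_(j > (ord0 : 'I_d.+1)) modulus (A j j)]%O.
have j0_max j : modulus (A j j) <= modulus (A j0 j0).
  by rewrite /j0; case: arg_maxP => // i _; apply.
suff -> : spectral_radius A = modulus (A j0 j0) by split=> //; exists j0.
have rad_max :
    ubound [set modulus a | a in [set a | eigenvalue A a]] (modulus (A j0 j0)).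
  by move=> _ [a /= /(eigenvalue_trig _ trigA)[j ->] <-].
have rad_in :
    [set modulus a | a in [set a | eigenvalue A a]] (modulus (A j0 j0)).
  by exists (A j0 j0) => //=; apply/(eigenvalue_trig _ trigA); exists j0.
apply/eqP; rewrite eq_le; apply/andP; split.
  by apply: ge_sup => //; exists (modulus (A j0 j0)).
by apply: ub_le_sup => //; exists (modulus (A j0 j0)).
Qed.

(** * Explicit remainder bounds for power series and the exponential *)

Lemma geometric_sum_le2 (R : realType) (y : R) (k M : nat) :
  0 <= y -> y <= 1 / 2 -> \sum_(k <= r < k + M) y ^+ r <= 2 * y ^+ k.
Proof.
move=> y_ge0 y_le; elim: M k => [|M IHM] k.
  by rewrite addn0 big_geq // mulr_ge0 // exprn_ge0.
rewrite big_ltn ?addnS ?ltnS ?leq_addr // -addSn.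
have := IHM k.+1; rewrite exprS; have : 0 <= y ^+ k by rewrite exprn_ge0.
nra.
Qed.

(** From order [k] on, the terms are dominated by a geometric series of ratio at most 1/2; the bound
    on partial sums passes to the limit. *)
Lemma power_series_tail (R : realType) (a : nat -> R) (C x t L : R) (k : nat) :
  0 <= x -> (forall r, `|a r| <= C * x ^+ r) -> x * `|t| <= 1 / 2 ->
  (\sum_(0 <= r < N) a r * t ^+ r) @[N --> \oo] --> L ->
  `|L - \sum_(0 <= r < k) a r * t ^+ r| <= 2 * C * (x * `|t|) ^+ k.
Proof.
move=> x_ge0 a_le xt_le aL.
have C_ge0 : 0 <= C.
  by have := a_le 0%N; rewrite expr0 mulr1; apply: le_trans.
have tailL : (`|\sum_(0 <= r < N) a r * t ^+ r - \sum_(0 <= r < k) a r * t ^+ r|)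
    @[N --> \oo] --> `|L - \sum_(0 <= r < k) a r * t ^+ r|.
  by apply: cvg_norm; apply: cvgB => //; exact: cvg_cst.
have cvgC : (2 * C * (x * `|t|) ^+ k) @[_ --> \oo] --> 2 * C * (x * `|t|) ^+ k.
  exact: cvg_cst.
apply: (ler_cvg_to tailL cvgC); exists k => // N /= le_kN.
rewrite (big_cat_nat (n := k)) //= addrAC subrr add0r.
apply: le_trans (ler_norm_sum _ _ _) _.
apply: (@le_trans _ _ (\sum_(k <= r < N) C * (x * `|t|) ^+ r)).
  apply: ler_sum => r _; rewrite normrM normrX exprMn mulrA.
  by apply: ler_wpM2r => //; rewrite exprn_ge0.
rewrite -mulr_sumr [2 * _]mulrC -mulrA; apply: ler_wpM2l => //.
by rewrite -(subnKC le_kN) geometric_sum_le2 // mulr_ge0.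
Qed.

Lemma expR_taylor (R : realType) (x : R) (k : nat) : `|x| <= 1 / 2 ->
  `|expR x - \sum_(0 <= r < k) x ^+ r / r`!%:R| <= 2 * `|x| ^+ k.
Proof.
move=> x_le.
have := @power_series_tail R (fun r => r`!%:R^-1) 1 1 x (expR x) k.
rewrite mulr1 mul1r => /(_ ler01).
under eq_bigr do rewrite mulrC.
apply=> //.
  move=> r; rewrite expr1n mulr1 ger0_norm ?invr_ge0 ?ler0n //.
  by rewrite invf_le1 ?ltr0n ?fact_gt0 // ler1n fact_gt0.
have := is_cvg_series_exp_coeff x; rewrite /expR => cvgx.
apply: cvg_trans cvgx; apply: near_eq_cvg; near=> N.
by rewrite /series /=; apply: eq_bigr => r _; rewrite mulrC.
Unshelve. all: by end_near. Qed.

Lemma expR_le_quadratic (R : realType) (x : R) : `|x| <= 1 / 2 ->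
  expR x <= 1 + x + 2 * x ^+ 2.
Proof.
move=> x_le; have := expR_taylor 2 x_le.
rewrite !big_nat_recr //= big_geq //= real_normK ?num_real //.
rewrite ler_norml => /andP[_]; rewrite expr0 expr1 !invr1; lra.
Qed.

(** Second-order Taylor expansion, in which [x ^+ 2] may be replaced by [(a * h) ^+ 2] up to order
    [h ^+ 3]. The constants do not depend on [x], so [x] may vary with [h]. *)
Lemma expR_of_expansion (R : realType) (a b D : R) : 0 <= D ->
  exists C h0 : R, [/\ 0 <= C, 0 < h0 & forall h x, 0 < h -> h <= h0 ->
    `|x - (a * h + b * h ^+ 2)| <= D * h ^+ 3 ->
    `|expR x - (1 + a * h + (b + a ^+ 2 / 2) * h ^+ 2)| <= C * h ^+ 3].
Proof.
move=> D_ge0; pose K := `|a| + `|b| + D.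
have K_ge0 : 0 <= K by rewrite !addr_ge0.
(* The three summands pay for the Taylor remainder, for replacing [x ^+ 2 / 2], and for replacing
   [x]. The threshold forces both [h <= 1] and [K * h <= 1 / 2]. *)
exists (2 * K ^+ 3 + (`|b| + D) * K + D), (1 / (2 * (K + 1))); split.
- by rewrite !addr_ge0 // mulr_ge0 ?exprn_ge0 ?addr_ge0.
- by rewrite divr_gt0 ?mulr_gt0 //; lra.
move=> h x h_gt0; rewrite ler_pdivlMr ?mulr_gt0 //; last by lra.
move=> h_le x_near.
have h_le1 : h <= 1 by nra.
have xah_le : `|x - a * h| <= (`|b| + D) * h ^+ 2.
  have -> : x - a * h = (x - (a * h + b * h ^+ 2)) + b * h ^+ 2 by ring.
  apply: le_trans (ler_normD _ _) _; rewrite normrM normrX (gtr0_norm h_gt0).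
  have : D * h ^+ 3 <= D * h ^+ 2 by rewrite ler_wpM2l // ler_wiXn2l // ltW.
  by rewrite mulrDl; lra.
have x_leK : `|x| <= K * h.
  have -> : x = (x - a * h) + a * h by ring.
  apply: le_trans (ler_normD _ _) _; rewrite normrM (gtr0_norm h_gt0).
  have : (`|b| + D) * h ^+ 2 <= (`|b| + D) * h.
    by rewrite ler_wpM2l ?addr_ge0 // expr2 ler_piMl // ltW.
  by rewrite /K; lra.
have x_half : `|x| <= 1 / 2 by nra.
have := expR_taylor 3 x_half.
rewrite !big_nat_recr //= big_geq // add0r expr0 expr1 => ex_near.
have ex_near' : `|expR x - (1 + x + x ^+ 2 / 2)| <= 2 * K ^+ 3 * h ^+ 3.
  apply: (le_trans _ (le_trans ex_near _)).
    by rewrite !invr1 !mulr1.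
  rewrite -mulrA -exprMn ler_pM2l // lerXn2r // ?nnegrE ?mulr_ge0 // ltW //.
have sq_near : `|x ^+ 2 / 2 - a ^+ 2 / 2 * h ^+ 2| <= (`|b| + D) * K * h ^+ 3.
  have -> : x ^+ 2 / 2 - a ^+ 2 / 2 * h ^+ 2 = (x - a * h) * ((x + a * h) / 2).
    by field.
  have -> : (`|b| + D) * K * h ^+ 3 = (`|b| + D) * h ^+ 2 * (K * h) by ring.
  rewrite normrM ler_pM //.
  rewrite normrM [X in _ * X]ger0_norm ?invr_ge0 // ler_pdivrMr //.
  apply: le_trans (ler_normD _ _) _; rewrite normrM (gtr0_norm h_gt0).
  have : `|a| * h <= K * h.
    by apply: ler_wpM2r; rewrite ?(ltW h_gt0) // /K -addrA lerDl addr_ge0.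
  lra.
have -> : expR x - (1 + a * h + (b + a ^+ 2 / 2) * h ^+ 2) =
  (expR x - (1 + x + x ^+ 2 / 2)) + (x ^+ 2 / 2 - a ^+ 2 / 2 * h ^+ 2)
  + (x - (a * h + b * h ^+ 2)) by ring.
rewrite [leRHS]mulrDl; apply: le_trans (ler_normD _ _) _; apply: lerD => //.
by rewrite [leRHS]mulrDl; apply: le_trans (ler_normD _ _) _; apply: lerD.
Qed.

(** * Moment generating function of a finitely supported law *)

Section weighted_mgf.
Variables (R : realType) (m : nat) (p : 'I_m -> R).
Hypotheses (p_ge0 : forall i, 0 <= p i) (p_sum1 : \sum_(i < m) p i = 1).

Definition weighted_mgf (z : 'I_m -> R) (t : R) : R :=
  \sum_i p i * expR (t * z i).

(** Jensen's inequality, by averaging [1 + u <= expR u] at [u = t * z i - t * mu], which has mean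
    zero. *)
Lemma expR_mean_le_weighted_mgf (z : 'I_m -> R) (t : R) :
  expR (t * \sum_i p i * z i) <= weighted_mgf z t.
Proof.
set mu := \sum_i p i * z i.
have : 1 <= \sum_i p i * expR (t * z i - t * mu).
  apply: (@le_trans _ _ (\sum_i p i * (1 + (t * z i - t * mu)))); last first.
    by apply: ler_sum => i _; rewrite ler_wpM2l // expR_ge1Dx.
  have -> : \sum_i p i * (1 + (t * z i - t * mu)) =
      \sum_i p i + (t * mu - (\sum_i p i) * (t * mu)).
    rewrite mulr_suml /mu mulr_sumr -sumrB -big_split /=.
    by apply: eq_bigr => i _; ring.
  by rewrite p_sum1 mul1r subrr addr0.
under eq_bigr do rewrite expRD expRN mulrA.
by rewrite -mulr_suml ler_pdivlMr ?expR_gt0 // mul1r.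
Qed.

Lemma weighted_mgf_gt0 (z : 'I_m -> R) (t : R) : 0 < weighted_mgf z t.
Proof. exact: lt_le_trans (expR_gt0 _) (expR_mean_le_weighted_mgf z t). Qed.

Lemma weighted_mgf_quadratic (z : 'I_m -> R) (t : R) :
  (forall i, `|t| * `|z i| <= 1 / 2) ->
  weighted_mgf z t <=
    1 + t * (\sum_i p i * z i) + 2 * t ^+ 2 * \sum_i p i * z i ^+ 2.
Proof.
move=> tz_le.
rewrite -[X in X + _ + _]p_sum1 !mulr_sumr -!big_split /=; apply: ler_sum => i _.
apply: (@le_trans _ _ (p i * (1 + t * z i + 2 * (t * z i) ^+ 2))).
  by rewrite ler_wpM2l // expR_le_quadratic // normrM.
by rewrite le_eqVlt; apply/orP; left; apply/eqP; ring.
Qed.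

(** At 0 the generating function equals 1 and its slope is the negative mean, so it drops below 1 at
    small positive arguments. *)
Lemma weighted_mgf_chernoff (z : 'I_m -> R) :
  \sum_i p i * z i < 0 ->
  exists theta c : R, [/\ 0 < theta, 0 < c & weighted_mgf z theta <= expR (- c)].
Proof.
set mu := \sum_i p i * z i => mu_lt0.
pose B := \sum_i `|z i| + 1; pose V := \sum_i p i * z i ^+ 2 + 1.
have B_gt0 : 0 < B by rewrite ltr_wpDl // sumr_ge0.
have V_gt0 : 0 < V.
  by rewrite ltr_wpDl // sumr_ge0 // => i _; rewrite mulr_ge0 ?sqr_ge0.
have z_le i : `|z i| <= B.
  by rewrite /B (bigD1 i) //= -addrA lerDl addr_ge0 // sumr_ge0.
(* The first bound gives [theta * |z i| <= 1 / 2]; the second makes the quadratic term at most half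
   of the linear gain. *)
pose theta := Num.min (1 / (2 * B)) (- mu / (4 * V)).
have theta_gt0 : 0 < theta.
  by rewrite lt_min !divr_gt0 ?oppr_gt0 // mulr_gt0.
have : theta <= 1 / (2 * B) by rewrite ge_min lexx.
rewrite ler_pdivlMr ?mulr_gt0 // => thetaB.
have : theta <= - mu / (4 * V) by rewrite ge_min lexx orbT.
rewrite ler_pdivlMr ?mulr_gt0 // => thetaV.
exists theta, (- (theta * mu / 2)); split=> //.
  by rewrite oppr_gt0 pmulr_llt0 // pmulr_rlt0.
rewrite opprK; apply: le_trans (expR_ge1Dx _).
apply: (le_trans (weighted_mgf_quadratic _)).
  move=> i; rewrite (gtr0_norm theta_gt0).
  apply: (@le_trans _ _ (theta * B)); first by rewrite ler_pM2l.
  by lra.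
have : \sum_i p i * z i ^+ 2 = V - 1 by rewrite addrK.
rewrite -/mu => ->.
by nra.
Qed.

Lemma eq0_of_le_linear (x C t0 : R) : 0 < t0 ->
  (forall t, 0 < t -> t <= t0 -> `|x| <= C * t) -> x = 0.
Proof.
move=> t0_gt0 x_le; apply/eqP; rewrite -normr_le0.
have [x_gt0|//] := ltP 0 `|x|; exfalso.
have C_gt0 : 0 < C.
  by have := x_le t0 t0_gt0 (lexx _); rewrite -(pmulr_lgt0 _ t0_gt0); lra.
pose t := Num.min t0 (`|x| / (2 * C)).
have t_gt0 : 0 < t by rewrite lt_min t0_gt0 divr_gt0 ?mulr_gt0.
have tt0 : t <= t0 by rewrite ge_min lexx.
have : t <= `|x| / (2 * C) by rewrite ge_min lexx orbT.
rewrite ler_pdivlMr ?mulr_gt0 //; have := x_le t t_gt0 tt0; lra.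
Qed.

(** Convergence of the cumulant series at one positive point makes its coefficients grow at most
    geometrically, which bounds the tails uniformly for smaller [t]; the linear coefficient is then
    matched with the mean. *)
Lemma ln_weighted_mgf_expansion (z : 'I_m -> R) (kappa : nat -> R) :
  (\forall t \near (0 : R),
    (\sum_(1 <= r < N) kappa r * t ^+ r / r`!%:R) @[N --> \oo] -->
      ln (weighted_mgf z t)) ->
  exists C t0 : R, [/\ 0 <= C, 0 < t0 & forall t, 0 < t -> t <= t0 ->
    `|ln (weighted_mgf z t) - (t * (\sum_i p i * z i) + kappa 2%N / 2 * t ^+ 2
       + kappa 3%N / 6 * t ^+ 3)| <= C * t ^+ 4].
Proof.
move=> /nbhs_ballP[e /= e_gt0 e_cvg].
pose a r : R := if r is 0 then 0 else kappa r / r`!%:R.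
pose t1 := e / 2.
have t1_gt0 : 0 < t1 by rewrite divr_gt0.
have cvg_a t : 0 < t -> t <= t1 ->
    (\sum_(0 <= r < N) a r * t ^+ r) @[N --> \oo] --> ln (weighted_mgf z t).
  move=> t_gt0 t_le.
  have t_ball : ball (0 : R) e t.
    by rewrite /ball /= sub0r normrN gtr0_norm // /t1 in t_le *; lra.
  apply: cvg_trans (e_cvg _ t_ball); apply: near_eq_cvg; exists 1%N => // N /= N1.
  rewrite [RHS]big_ltn // mul0r add0r; apply: eq_big_nat => -[//|r] _.
  by rewrite /a mulrAC.
(* The terms of the series convergent at [t1] are bounded, whence [|a r| <= C1 / t1 ^+ r]. *)
have := cvg_series_bounded (cvgP _ (cvg_a t1 t1_gt0 (lexx _))).
move=> [C0 [_ /(_ (C0 + 1))]]; rewrite ltrDl ltr01 => /(_ isT) a_bnd.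
pose C1 := `|C0 + 1|.
have a_le r : `|a r| <= C1 * t1^-1 ^+ r.
  rewrite exprVn ler_pdivlMr ?exprn_gt0 // -(gtr0_norm (exprn_gt0 r t1_gt0)) -normrM.
  by apply: le_trans (a_bnd r I) _; exact: ler_norm.
have tail t k : 0 < t -> t <= t1 / 2 ->
    `|ln (weighted_mgf z t) - \sum_(0 <= r < k) a r * t ^+ r|
      <= 2 * C1 * (t1^-1 * t) ^+ k.
  move=> t_gt0 t_le; rewrite -[in leRHS](gtr0_norm t_gt0).
  apply: power_series_tail => //.
  - by rewrite invr_ge0 ltW.
  - by rewrite gtr0_norm // mulrC ler_pdivrMr // mulrC mul1r; lra.
  - by apply: cvg_a => //; lra.
set mu := \sum_i p i * z i.
(* Jensen gives t mu <= ln M(t), and ln (1 + u) <= u gives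
   ln M(t) <= t mu + O(t^2); compare with the series at order 1. *)
have kappa1 : kappa 1%N = mu.
  pose B := \sum_i `|z i| + 1; pose V := \sum_i p i * z i ^+ 2.
  have B_gt0 : 0 < B by rewrite ltr_wpDl // sumr_ge0.
  have V_ge0 : 0 <= V.
    by rewrite sumr_ge0 // => i _; rewrite mulr_ge0 ?sqr_ge0.
  have z_le i : `|z i| <= B.
    by rewrite /B (bigD1 i) //= -addrA lerDl addr_ge0 // sumr_ge0.
  apply/eqP; rewrite -subr_eq0; apply/eqP.
  (* [2 * V] comes from the quadratic bound on the generating function, the other summand from the
     series tail from order 2 on. *)
  apply: (@eq0_of_le_linear _ (2 * V + 2 * C1 * t1^-1 ^+ 2)
    (Num.min (t1 / 2) (1 / (2 * B)))).
    by rewrite lt_min !divr_gt0 ?mulr_gt0.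
  move=> t t_gt0; rewrite le_min => /andP[t_le].
  rewrite ler_pdivlMr ?mulr_gt0 // => tB_le.
  have lnM_ge : t * mu <= ln (weighted_mgf z t).
    rewrite -[leLHS]expRK ler_ln ?posrE ?expR_gt0 ?weighted_mgf_gt0 //.
    exact: expR_mean_le_weighted_mgf.
  have lnM_le : ln (weighted_mgf z t) <= t * mu + 2 * t ^+ 2 * V.
    have M_le : weighted_mgf z t <= 1 + t * mu + 2 * t ^+ 2 * V.
      apply: weighted_mgf_quadratic => i; rewrite (gtr0_norm t_gt0).
      apply: (@le_trans _ _ (t * B)); first by rewrite ler_pM2l.
      by lra.
    have := @le_ln1Dx _ (weighted_mgf z t - 1).
    have := weighted_mgf_gt0 z t.
    by rewrite addrCA subrr addr0 => M_gt0 H; have := H _; lra.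
  have := tail t 2%N t_gt0 t_le.
  rewrite !big_nat_recr //= big_geq // add0r mul0r add0r expr1 divr1.
  move=> lnM_near.
  have : `|(kappa 1%N - mu) * t| <= (2 * V + 2 * C1 * t1^-1 ^+ 2) * t * t.
    have -> : (kappa 1%N - mu) * t = - (ln (weighted_mgf z t) - kappa 1%N * t)
      + (ln (weighted_mgf z t) - t * mu) by ring.
    apply: le_trans (ler_normD _ _) _; rewrite normrN.
    rewrite [X in _ + X]ger0_norm ?subr_ge0 //.
    move: lnM_near; rewrite exprMn; lra.
  by rewrite normrM (gtr0_norm t_gt0) ler_pM2r.
exists (2 * C1 * t1^-1 ^+ 4), (t1 / 2); split.
- apply: mulr_ge0; first by apply: mulr_ge0; rewrite // normr_ge0.
  by rewrite exprn_ge0 // invr_ge0 ltW.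
- by rewrite divr_gt0.
move=> t t_gt0 t_le; have := tail t 4%N t_gt0 t_le.
rewrite !big_nat_recr //= big_geq // exprMn [leRHS]mulrA; apply: le_trans.
rewrite le_eqVlt; apply/orP; left; apply/eqP; congr (`|_ - _|).
by rewrite -kappa1 !add0r !factS fact0 /=; field.
Qed.

End weighted_mgf.

(** * The random spectral radius as a maximum of geometric means *)

Definition prefix_geomean (R : realType) (m n : nat) (z : 'I_m -> R)
    (s : {ffun 'I_n -> 'I_m}) : R :=
  expR ((\sum_(k < n) z (s k)) / n%:R).

(** Geometric means are positive, so the default 0 is never the maximum once [d > 0]. *)
Definition max_geomean (R : realType) (m d n : nat) (z : 'I_d -> 'I_m -> R)
    (s : {ffun 'I_n -> 'I_m}) : R :=
  \big[Num.max/0]_(j < d) prefix_geomean (z j) s.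

Lemma modulus_ge0 (R : realType) (x : R[i]) : 0 <= modulus x.
Proof. by case: x => a b; exact: sqrtr_ge0. Qed.

Lemma max_geomean_ge0 (R : realType) (m d n : nat) (z : 'I_d -> 'I_m -> R)
    (s : {ffun 'I_n -> 'I_m}) :
  0 <= max_geomean z s.
Proof. exact: bigmax_ge_id. Qed.

Lemma geomean_le_max (R : realType) (m d n : nat) (z : 'I_d -> 'I_m -> R)
    (s : {ffun 'I_n -> 'I_m}) (j : 'I_d) :
  prefix_geomean (z j) s <= max_geomean z s.
Proof. exact: (le_bigmax 0 (fun j => prefix_geomean (z j) s)). Qed.

Lemma modulus_prod (R : realType) (I : finType) (F : I -> R[i]) :
  modulus (\prod_i F i) = \prod_i modulus (F i).
Proof. exact: (big_morph _ (@Normc.normcM R) (Normc.normc1 R)). Qed.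

Lemma expR_log_diag (R : realType) (m d : nat) (T : 'I_m -> 'M[R[i]]_d)
    (T_diag : forall i j, T i j j != 0) (i : 'I_m) (j : 'I_d) :
  expR (log_diag T j i) = modulus (T i j j).
Proof.
rewrite lnK // posrE lt_def modulus_ge0 andbT.
by apply: contra_neq (T_diag i j) => /Normc.eq0_normc.
Qed.

(** Pathwise, the [n]-th root of the modulus of each diagonal entry of the product is a geometric
    mean, and taking roots is monotone, so it commutes with the maximum. At [n = 0] both sides are
    1. *)
Lemma random_spectral_radiusE (R : realType) (m d : nat)
    (T : 'I_m -> 'M[R[i]]_d) (Omega : Type) (idx : nat -> Omega -> 'I_m)
    (T_trig : (forall i, is_trig_mx (T i)^T) \/ (forall i, is_trig_mx (T i)))
    (T_diag : forall i j, T i j j != 0) (n : nat) :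
  (0 < d)%N ->
  random_spectral_radius T idx n =
  fun w => max_geomean (log_diag T) [ffun k : 'I_n => idx k w].
Proof.
move=> d_gt0; apply/funext => w; rewrite /random_spectral_radius.
set A := left_product T (idx ^~ w) n.
have [trigA diagA] := left_product_trig T_trig (idx ^~ w) n.
rewrite -/A in trigA diagA.
have geoE j : modulus (A j j) `^ (n%:R)^-1 =
    prefix_geomean (log_diag T j) [ffun k : 'I_n => idx k w].
  rewrite diagA modulus_prod /prefix_geomean expRM expR_sum.
  by congr (_ `^ _); apply: eq_bigr => k _; rewrite ffunE expR_log_diag.
have [rad_ge [j0 rad_eq]] := spectral_radius_trig d_gt0 trigA.
apply/eqP; rewrite eq_le; apply/andP; split.
  by rewrite rad_eq geoE; apply: geomean_le_max.
apply: bigmax_le => [|j _]; first exact: powR_ge0.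
rewrite -geoE ge0_ler_powR ?invr_ge0 // nnegrE ?modulus_ge0 //.
by rewrite rad_eq modulus_ge0.
Qed.

(** * Exponentially small contribution of the non-dominant exponents *)

Section dominant_exponent.
Variables (R : realType) (m d : nat) (p : 'I_m -> R).
Hypotheses (p_ge0 : forall i, 0 <= p i) (p_sum1 : \sum_(i < m) p i = 1).
Variables (z : 'I_d -> 'I_m -> R) (jstar : 'I_d).
Hypothesis mean_lt : forall j, j != jstar ->
  \sum_i p i * z j i < \sum_i p i * z jstar i.

Lemma prefix_mean_geomeanX (n q : nat) (y : 'I_m -> R) :
  prefix_mean p (fun s : {ffun 'I_n -> 'I_m} => prefix_geomean y s ^+ q) =
  weighted_mgf p y (q%:R / n%:R) ^+ n.
Proof.
rewrite -prefix_mean_prod; congr (prefix_mean p _); apply/funext => s.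
rewrite /prefix_geomean -expRM_natl -expR_sum; congr expR.
by rewrite -mulr_sumr; ring.
Qed.

(** The differences [z j - z jstar] have negative mean, so each satisfies a Chernoff bound; as there
    are finitely many [j], one rate [c] serves all. *)
Lemma chernoff_uniform : exists (theta : 'I_d -> R) (c : R),
  [/\ forall j, 0 < theta j, 0 < c & forall j, j != jstar ->
  weighted_mgf p (fun i => z j i - z jstar i) (theta j) <= expR (- c)].
Proof.
have chernoff j : exists tc : R * R, [/\ 0 < tc.1, 0 < tc.2 & j != jstar ->
    weighted_mgf p (fun i => z j i - z jstar i) tc.1 <= expR (- tc.2)].
  have [->|neq_j] := eqVneq j jstar; first by exists (1, 1).
  have [|t [c [t_gt0 c_gt0 le_c]]] :=
      @weighted_mgf_chernoff _ _ p p_ge0 p_sum1 (fun i => z j i - z jstar i).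
    under eq_bigr do rewrite mulrBr.
    by rewrite sumrB subr_lt0 mean_lt.
  by exists (t, c).
have [tc tcP] := choice chernoff.
exists (fun j => (tc j).1), (\big[Num.min/1]_j (tc j).2); split.
- by move=> j; have [] := tcP j.
- by apply: lt_bigmin => // j _; have [] := tcP j.
move=> j neq_j; have [_ _ /(_ neq_j) le_tc] := tcP j.
by apply: le_trans le_tc _; rewrite ler_expR lerN2 bigmin_le_cond.
Qed.

Lemma max_geomean_attained (n : nat) (s : {ffun 'I_n -> 'I_m}) :
  exists j, max_geomean z s = prefix_geomean (z j) s.
Proof.
have [//|j _|j _ eq_j] := @eq_bigmax _ _ _ (0 : R) jstar predT
  (fun j => prefix_geomean (z j) s); last by exists j.
exact: expR_ge0.
Qed.

Lemma geomean_bounded : exists2 B : R, 0 <= B &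
  forall n (s : {ffun 'I_n -> 'I_m}) j, (0 < n)%N -> prefix_geomean (z j) s <= B.
Proof.
pose b := \sum_j \sum_i `|z j i|.
exists (expR b) => [|n s j n_gt0]; first exact: expR_ge0.
rewrite ler_expR ler_pdivrMr ?ltr0n // mulr_natr -[in leRHS](card_ord n) -sumr_const.
apply: ler_sum => k _; apply: le_trans (ler_norm _) _.
rewrite /b (bigD1 j) //= (bigD1 (s k)) //= -addrA lerDl.
by rewrite addr_ge0 ?sumr_ge0 // => j' _; rewrite sumr_ge0.
Qed.

(** The maximum exceeds the dominant geometric mean only on words where another exponent sum wins.
    There an exponential tilt is at least 1, so the discrepancy is at most [B ^+ q] times the sum of
    the tilts, each of mean at most [expR (- (c * n))]. *)
Lemma max_geomean_error : exists (B c : R), [/\ 0 <= B, 0 < c,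
  forall n (s : {ffun 'I_n -> 'I_m}), (0 < n)%N -> max_geomean z s <= B
  & forall n q, (0 < n)%N ->
    0 <= prefix_mean p (fun s : {ffun 'I_n -> 'I_m} => max_geomean z s ^+ q)
         - prefix_mean p (fun s : {ffun 'I_n -> 'I_m} => prefix_geomean (z jstar) s ^+ q)
      <= B ^+ q * d%:R * expR (- (c * n%:R))].
Proof.
have [theta [c [theta_gt0 c_gt0 le_c]]] := chernoff_uniform.
have [B B_ge0 le_B] := geomean_bounded.
have max_le n (s : {ffun 'I_n -> 'I_m}) : (0 < n)%N -> max_geomean z s <= B.
  by move=> n_gt0; have [j ->] := max_geomean_attained s; exact: le_B.
exists B, c; split=> // n q n_gt0.
have le_pow (s : {ffun 'I_n -> 'I_m}) :
    prefix_geomean (z jstar) s ^+ q <= max_geomean z s ^+ q.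
  by rewrite lerXn2r ?nnegrE ?expR_ge0 ?max_geomean_ge0 ?geomean_le_max.
rewrite subr_ge0 le_prefix_mean //=.
(* Each tilt is positive, and tilt j s >= 1 as soon as S_j >= S_jstar. *)
pose tilt j (s : {ffun 'I_n -> 'I_m}) :=
  \prod_(k < n) expR (theta j * (z j (s k) - z jstar (s k))).
have le_tilt (s : {ffun 'I_n -> 'I_m}) : max_geomean z s ^+ q <=
    prefix_geomean (z jstar) s ^+ q + B ^+ q * \sum_(j | j != jstar) tilt j s.
  have sum_ge0 (Q : pred 'I_d) : 0 <= \sum_(j | Q j) tilt j s.
    by apply: sumr_ge0 => j _; apply: prodr_ge0 => k _; exact: expR_ge0.
  have [j max_eq] := max_geomean_attained s.
  have [eq_j|neq_j] := eqVneq j jstar.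
    by rewrite max_eq eq_j lerDl mulr_ge0 ?exprn_ge0.
  apply: (@le_trans _ _ (B ^+ q)).
    by rewrite lerXn2r ?nnegrE ?max_geomean_ge0 ?max_le.
  apply: (@le_trans _ _ (B ^+ q * \sum_(j | j != jstar) tilt j s)); last first.
    by rewrite lerDr exprn_ge0 ?expR_ge0.
  rewrite ler_peMr ?exprn_ge0 // (bigD1 j) //=.
  apply: (@le_trans _ _ (tilt j s)); last by rewrite lerDl.
  rewrite /tilt -expR_sum -mulr_sumr sumrB.
  have := geomean_le_max z s jstar.
  rewrite max_eq ler_expR ler_pM2r ?invr_gt0 ?ltr0n // => le_sum.
  apply: le_trans (expR_ge1Dx _); rewrite lerDl mulr_ge0 ?subr_ge0 //.
  exact: ltW.
rewrite lerBlDl; apply: le_trans (le_prefix_mean p_ge0 le_tilt) _.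
rewrite prefix_meanD prefix_meanZ lerD2l -mulrA ler_wpM2l ?exprn_ge0 //.
have -> : (fun s => \sum_(j | j != jstar) tilt j s) =
    (fun s => \sum_j if j != jstar then tilt j s else 0).
  by apply/funext => s; rewrite big_mkcond.
rewrite prefix_mean_sum mulr_natl -[in leRHS](card_ord d) -sumr_const.
(* The index [jstar] contributes 0 but is counted as well, which gives the factor [d]. *)
apply: ler_sum => j _; have [_|neq_j] := eqVneq j jstar.
  by rewrite prefix_mean_cst // expR_ge0.
rewrite /tilt (prefix_mean_prod _ _ (fun i => expR (theta j * (z j i - z jstar i)))).
rewrite -mulNr expRM_natr lerXn2r ?nnegrE ?expR_ge0 //.
  exact: ltW (weighted_mgf_gt0 _ _ _ _).
exact: le_c.
Qed.

End dominant_exponent.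

(** * Asymptotic comparison and expansion of the moments *)

Lemma eqO_of_bound (R : realType) (f g : nat -> R) (C : R) (N : nat) :
  (forall n, (N <= n)%N -> `|f n| <= C * `|g n|) -> f =O_\oo g.
Proof.
move=> f_le; apply/eqOP; exists C; split; first exact: num_real.
move=> k Ck; exists N => // n /= /f_le f_le_n; apply: le_trans f_le_n _.
apply: ler_wpM2r => //.
exact: ltW.
Qed.

(** The term of degree [k + 2] of the exponential series suffices: [k] powers of [n] match the
    target scale, one absorbs the factor [n], and one provides the decay. *)
Lemma eqo_of_exp_bound (R : realType) (f : nat -> R) (D c : R) (k : nat) :
  0 < c -> 0 <= D ->
  (forall n, (0 < n)%N -> `|f n| <= D * n%:R * expR (- (c * n%:R))) ->
  f =o_\oo (fun n : nat => (n%:R : R) ^- k).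
Proof.
move=> c_gt0 D_ge0 f_le; apply/eqoP => e e_gt0.
pose A := c ^+ k.+2 / (k.+2)`!%:R.
have A_gt0 : 0 < A by rewrite divr_gt0 ?exprn_gt0 // ltr0n fact_gt0.
exists (Num.truncn (D / (A * e))).+1 => // n /= n_ge.
have n_gt0 : (0 < n)%N by apply: leq_trans n_ge.
have nR_gt0 : 0 < n%:R :> R by rewrite ltr0n.
have n_large : D <= n%:R * (A * e).
  have Ae_gt0 : 0 < A * e by exact: mulr_gt0.
  rewrite -(ler_pdivrMr _ _ Ae_gt0).
  by apply/ltW/(lt_le_trans (truncnS_gt _)); rewrite ler_nat.
apply: le_trans (f_le n n_gt0) _.
rewrite (ger0_norm (_ : 0 <= (n%:R : R) ^- k)) ?invr_ge0 ?exprn_ge0 //.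
have exp_ge : A * n%:R ^+ k.+2 <= expR (c * n%:R).
  have := expR_ge1Dxn k.+1 (ltW (mulr_gt0 c_gt0 nR_gt0)).
  by rewrite exprMn mulrAC -/A; lra.
rewrite expRN ler_pdivrMr ?expR_gt0 // mulrAC ler_pdivlMr ?exprn_gt0 //.
apply: (@le_trans _ _ (e * (A * n%:R ^+ k.+2))); last by rewrite ler_pM2l.
have -> : e * (A * n%:R ^+ k.+2) = n%:R * (A * e) * n%:R * n%:R ^+ k.
  by rewrite !exprS; ring.
by rewrite !ler_wpM2r // exprn_ge0.
Qed.

(* With S the exponent sum, the pairs (q, l) = (1, 1), (2, 1), (1, 2) cover
   E[exp(S/n)], E[exp(S/n)^2] and E[exp(S/n)]^2. *)
Lemma weighted_mgf_power_expansion (R : realType) (m : nat) (p z : 'I_m -> R)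
    (kappa : nat -> R) (p_ge0 : forall i, 0 <= p i)
    (p_sum1 : \sum_(i < m) p i = 1) (q l : nat) :
  (\forall t \near (0 : R),
    (\sum_(1 <= r < N) kappa r * t ^+ r / r`!%:R) @[N --> \oo] -->
      ln (weighted_mgf p z t)) ->
  (0 < q)%N ->
  let a := l%:R * q%:R ^+ 2 * kappa 2%N / 2 in
  let b := l%:R * q%:R ^+ 3 * kappa 3%N / 6 in
  exists (C : R) (N : nat), [/\ 0 <= C, (0 < N)%N & forall n, (N <= n)%N ->
    `|expR (- (l%:R * q%:R * \sum_i p i * z i))
       * (weighted_mgf p z (q%:R / n%:R) ^+ n) ^+ l
      - (1 + a / n%:R + (b + a ^+ 2 / 2) / n%:R ^+ 2)| <= C / n%:R ^+ 3].
Proof.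
move=> kappaP q_gt0 a b; set mu := \sum_i p i * z i.
have [C [t0 [C_ge0 t0_gt0 lnM_near]]] :=
  ln_weighted_mgf_expansion p_ge0 p_sum1 kappaP.
pose D := l%:R * C * q%:R ^+ 4.
have D_ge0 : 0 <= D by rewrite mulr_ge0 ?exprn_ge0 // mulr_ge0.
have [C1 [h0 [C1_ge0 h0_gt0 exp_near]]] := expR_of_expansion a b D_ge0.
have qR_gt0 : 0 < q%:R :> R by rewrite ltr0n.
(* Beyond this threshold [q / n <= t0] and [1 / n <= h0]. *)
exists C1, (Num.truncn (q%:R / t0 + 1 / h0)).+1; split=> // n n_ge.
have nR_gt : q%:R / t0 + 1 / h0 < n%:R.
  by apply: lt_le_trans (truncnS_gt _) _; rewrite ler_nat.
have q_t0 : 0 < q%:R / t0 by rewrite divr_gt0.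
have h0_inv : 0 < 1 / h0 by rewrite divr_gt0.
have nR_gt0 : 0 < n%:R :> R by lra.
have h_gt0 : 0 < n%:R^-1 :> R by rewrite invr_gt0.
have h_le : n%:R^-1 <= h0.
  by rewrite -[h0]invrK lef_pV2 ?posrE ?invr_gt0 //; lra.
have t_le : q%:R / n%:R <= t0.
  by rewrite ler_pdivrMr // mulrC -ler_pdivrMr //; lra.
have := lnM_near _ (divr_gt0 qR_gt0 nR_gt0) t_le.
set t := q%:R / n%:R; set M := weighted_mgf p z t => lnM.
have M_gt0 : 0 < M by exact: weighted_mgf_gt0.
(* [x] is the logarithm of the normalized moment: subtracting the mean cancels the constant term,
   and the remainder is at most [l * n * C * (q / n) ^+ 4 = D / n ^+ 3]. *)
pose x := l%:R * (n%:R * ln M) - l%:R * q%:R * mu.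
have -> : expR (- (l%:R * q%:R * mu)) * (M ^+ n) ^+ l = expR x.
  by rewrite /x addrC expRD !expRM_natl lnK.
have := exp_near _ x h_gt0 h_le; rewrite !exprVn; apply.
have -> : x - (a * n%:R^-1 + b * n%:R ^- 2) =
    l%:R * n%:R * (ln M - (t * mu + kappa 2%N / 2 * t ^+ 2 + kappa 3%N / 6 * t ^+ 3)).
  by rewrite /x /a /b /t; field; rewrite ?gt_eqF.
rewrite normrM ger0_norm ?mulr_ge0 //.
apply: (@le_trans _ _ (l%:R * n%:R * (C * t ^+ 4))).
  by rewrite ler_wpM2l ?mulr_ge0.
rewrite le_eqVlt; apply/orP; left; apply/eqP; rewrite /D /t.
by field; rewrite ?gt_eqF.
Qed.

(** * Assembling the expansions of the mean and the variance *)

Lemma rho_inftyE (R : realType) (m d : nat) (T : 'I_m -> 'M[R[i]]_d)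
    (p : 'I_m -> R) (T_diag : forall i j, T i j j != 0) (j : 'I_d) :
  rho_infty T p j = expR (\sum_i p i * log_diag T j i).
Proof.
rewrite expR_sum; apply: eq_bigr => i _.
by rewrite -expR_log_diag // mulrC expRM.
Qed.

Lemma mmt_gen_fun_weighted (R : realType) (m : nat) (p z : 'I_m -> R)
    (disp : measure_display) (Omega : measurableType disp)
    (P : probability Omega R) (idx : nat -> Omega -> 'I_m) (t : R) :
  iid_with_law P p idx ->
  mmt_gen_fun P (z \o idx 0%N) t = (weighted_mgf p z t)%:E.
Proof.
move=> [midx Pidx _].
rewrite -(expectation_discrete_rv (fun i => expR (t * z i)) (midx 0%N) (Pidx 0%N)).
rewrite /mmt_gen_fun; congr (expectation P); apply/funext => w /=.
by rewrite mulrC.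
Qed.

Theorem theorem5 (R : realType) (m d : nat) (T : 'I_m -> 'M[R[i]]_d)
    (p : 'I_m -> R) (disp : measure_display) (Omega : measurableType disp)
    (P : probability Omega R) (idx : nat -> Omega -> 'I_m) (jstar : 'I_d)
    (kappa : nat -> R)
    (p_ge0 : forall i, 0 <= p i) (p_sum1 : \sum_(i < m) p i = 1)
    (idx_iid : iid_with_law P p idx)
    (T_trig : (forall i, is_trig_mx (T i)^T) \/ (forall i, is_trig_mx (T i)))
    (T_diag : forall i j, T i j j != 0)
    (argmax_jstar :
      [set j | forall k, rho_infty T p k <= rho_infty T p j] = [set jstar])
    (kappaP : is_cumulant_sequence P (log_diag T jstar \o idx 0%N) kappa) :
  let rho := random_spectral_radius T idx in
  let rhooo := rho_infty T p jstar in
  exists2 c : R, 0 < c &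
  exists eE dE eV dV : nat -> R,
    [/\ (forall n : nat, (0 < n)%N ->
           'E_P[rho n] =
           (rhooo * (1 + kappa 2%N / (2 * n%:R)
                       + (kappa 3%N / 6 + kappa 2%N ^+ 2 / 8) / n%:R ^+ 2
                       + eE n)
            + dE n)%:E)%E,
        (forall n : nat, (0 < n)%N ->
           n%:R%:E * variance P (rho n) =
           (rhooo ^+ 2 * (kappa 2%N
                       + (2 * kappa 3%N + 3 * kappa 2%N ^+ 2) / (2 * n%:R)
                       + eV n)
            + dV n)%:E)%E,
        (eE =O_\oo (fun n : nat => (n%:R : R) ^- 3)) /\
        (dE =O_\oo (fun n : nat => expR (- (c * n%:R)) : R)),
        (eV =O_\oo (fun n : nat => (n%:R : R) ^- 2)) /\
        (dV =O_\oo (fun n : nat => n%:R * expR (- (c * n%:R)) : R))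
      & forall k : nat,
        (dE =o_\oo (fun n : nat => (n%:R : R) ^- k)) /\
        (dV =o_\oo (fun n : nat => (n%:R : R) ^- k))].
Proof.
move=> rho rhooo.
have d_gt0 : (0 < d)%N by exact: leq_ltn_trans (leq0n _) (ltn_ord jstar).
pose z := log_diag T; pose mu := \sum_i p i * z jstar i.
(* Strictness comes from uniqueness of the maximizer: otherwise [j] would maximize [rho_infty]
   too. *)
have mean_lt j : j != jstar -> \sum_i p i * z j i < mu.
  move=> neq_j; rewrite ltNge; apply/negP => le_j.
  have jstar_max : [set j | forall k, rho_infty T p k <= rho_infty T p j] jstar.
    by rewrite argmax_jstar.
  have : [set j | forall k, rho_infty T p k <= rho_infty T p j] j.
    move=> k /=; apply: le_trans (jstar_max k) _.
    by rewrite !rho_inftyE // ler_expR.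
  by rewrite argmax_jstar /= => eq_j; rewrite eq_j eqxx in neq_j.
have series_ln : \forall t \near (0 : R),
    (\sum_(1 <= r < N) kappa r * t ^+ r / r`!%:R) @[N --> \oo] -->
      ln (weighted_mgf p (z jstar) t).
  apply: filterS kappaP => t [_].
  by rewrite (mmt_gen_fun_weighted _ _ idx_iid).
(* [H] gives the moments of the dominant geometric mean, [G] those of [rho n]. *)
pose H n q := weighted_mgf p (z jstar) (q%:R / n%:R) ^+ n.
pose G n q := prefix_mean p (fun s : {ffun 'I_n -> 'I_m} => max_geomean z s ^+ q).
have [B [c [B_ge0 c_gt0 max_le GH]]] := max_geomean_error p_ge0 p_sum1 mean_lt.
have {}GH n q : (0 < n)%N ->
    0 <= G n q - H n q <= B ^+ q * d%:R * expR (- (c * n%:R)).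
  by move=> n_gt0; rewrite /H -prefix_mean_geomeanX; exact: GH.
have E_rho n : ('E_P[rho n] = (G n 1%N)%:E)%E.
  rewrite /rho random_spectral_radiusE //.
  exact: (expectation_prefix idx_iid (fun s => max_geomean z s)).
have V_rho n : (variance P (rho n) = (G n 2%N - G n 1%N ^+ 2)%:E)%E.
  rewrite /rho random_spectral_radiusE //.
  exact: (variance_prefix p_sum1 idx_iid (fun s => max_geomean z s)).
have rhoooE : rhooo = expR mu by exact: rho_inftyE.
pose v := expR (- mu).
have rhooo_v : rhooo * v = 1 by rewrite rhoooE /v expRN divff // gt_eqF ?expR_gt0.
have [C1 [N1 [C1_ge0 N1_gt0 near1]]] := weighted_mgf_power_expansion
  p_ge0 p_sum1 1 series_ln (isT : (0 < 1)%N).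
have [C2 [N2 [C2_ge0 N2_gt0 near2]]] := weighted_mgf_power_expansion
  p_ge0 p_sum1 1 series_ln (isT : (0 < 2)%N).
have [C3 [N3 [C3_ge0 N3_gt0 near3]]] := weighted_mgf_power_expansion
  p_ge0 p_sum1 2 series_ln (isT : (0 < 1)%N).
(* The errors are exact differences, so both identities become algebra: [eE] and [eV] compare [H]
   with its expansion, [dE] and [dV] compare [G] with [H]. *)
pose eE n := v * H n 1%N - (1 + kappa 2%N / (2 * n%:R)
  + (kappa 3%N / 6 + kappa 2%N ^+ 2 / 8) / n%:R ^+ 2).
pose dE n := G n 1%N - H n 1%N.
pose eV n := n%:R * (v ^+ 2 * (H n 2%N - H n 1%N ^+ 2))
  - (kappa 2%N + (2 * kappa 3%N + 3 * kappa 2%N ^+ 2) / (2 * n%:R)).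
pose dV n := n%:R * ((G n 2%N - G n 1%N ^+ 2) - (H n 2%N - H n 1%N ^+ 2)).
have dE_le n : (0 < n)%N -> `|dE n| <= B * d%:R * expR (- (c * n%:R)).
  by move=> n_gt0; have /andP[? ?] := GH n 1%N n_gt0; rewrite ger0_norm.
(* The second summand bounds the difference of the squared means, factored with
   [G n 1 + H n 1 <= 2 * B]. *)
pose D := B ^+ 2 * d%:R + B * d%:R * (2 * B).
have D_ge0 : 0 <= D by rewrite addr_ge0 // !mulr_ge0 // exprn_ge0.
have dV_le n : (0 < n)%N -> `|dV n| <= D * (n%:R * expR (- (c * n%:R))).
  move=> n_gt0.
  have G_le : G n 1%N <= B.
    rewrite -[leRHS](prefix_mean_cst p_sum1 n B); apply: le_prefix_mean => // s.
    exact: max_le.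
  have H_ge0 : 0 <= H n 1%N.
    by rewrite exprn_ge0 // ltW // weighted_mgf_gt0.
  have /andP[dE_ge0 dE_le1] := GH n 1%N n_gt0.
  have /andP[d2_ge0 d2_le] := GH n 2%N n_gt0.
  have GH_ge0 : 0 <= G n 1%N + H n 1%N by lra.
  have -> : dV n = n%:R * ((G n 2%N - H n 2%N)
      - (G n 1%N - H n 1%N) * (G n 1%N + H n 1%N)) by rewrite /dV; ring.
  rewrite normrM ger0_norm // mulrCA ler_wpM2l //.
  apply: le_trans (ler_normB _ _) _; rewrite normrM !ger0_norm //.
  rewrite /D [leRHS]mulrDl lerD // [leRHS]mulrAC.
  by apply: ler_pM => //; lra.
exists c => //; exists eE, dE, eV, dV; split.
- move=> n n_gt0; rewrite E_rho; congr (_%:E).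
  transitivity (rhooo * v * H n 1%N + dE n); first by rewrite rhooo_v /dE; ring.
  by rewrite /eE; ring.
- move=> n n_gt0; rewrite V_rho -EFinM; congr (_%:E).
  transitivity ((rhooo * v) ^+ 2 * (n%:R * (H n 2%N - H n 1%N ^+ 2)) + dV n).
    by rewrite rhooo_v /dV; ring.
  by rewrite /eV; ring.
- split.
  + apply: (@eqO_of_bound _ _ _ C1 N1) => n n_ge.
    have n_neq0 : n%:R != 0 :> R by rewrite pnatr_eq0 -lt0n (leq_trans N1_gt0).
    rewrite (ger0_norm (_ : 0 <= (n%:R : R) ^- 3)) ?invr_ge0 ?exprn_ge0 //.
    have := near1 n n_ge; rewrite (_ : expR _ = v); last first.
      by congr expR; rewrite /mu; ring.
    apply: le_trans; rewrite le_eqVlt; apply/orP; left; apply/eqP.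
    by congr (`|_|); rewrite /eE -/(H n 1%N); field.
  + apply: (@eqO_of_bound _ _ _ (B * d%:R) 1) => n n_ge.
    by rewrite (ger0_norm (expR_ge0 _)) dE_le.
- split.
  + apply: (@eqO_of_bound _ _ _ (C2 + C3) (maxn N2 N3)) => n.
    rewrite geq_max => /andP[n_ge2 n_ge3].
    have n_neq0 : n%:R != 0 :> R by rewrite pnatr_eq0 -lt0n (leq_trans N2_gt0).
    rewrite (ger0_norm (_ : 0 <= (n%:R : R) ^- 2)) ?invr_ge0 ?exprn_ge0 //.
    have := near2 n n_ge2; rewrite (_ : expR _ = v ^+ 2); last first.
      by rewrite /v -expRM_natl; congr expR; rewrite /mu; ring.
    have := near3 n n_ge3; rewrite (_ : expR _ = v ^+ 2); last first.
      by rewrite /v -expRM_natl; congr expR; rewrite /mu; ring.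
    rewrite -/(H n 1%N) -/(H n 2%N); set e3 := _ - _; set e2 := _ - _ => e3_le e2_le.
    (* The constant terms of the second moment and the squared mean cancel; the factor [n] turns
       errors of order [n ^- 3] into [n ^- 2]. *)
    have -> : eV n = n%:R * (e2 - e3) by rewrite /eV /e2 /e3; field.
    rewrite normrM ger0_norm //.
    apply: (@le_trans _ _ (n%:R * (C2 / n%:R ^+ 3 + C3 / n%:R ^+ 3))).
      by rewrite ler_wpM2l // (le_trans (ler_normB _ _)) // lerD.
    by rewrite le_eqVlt; apply/orP; left; apply/eqP; field.
  + apply: (@eqO_of_bound _ _ _ D 1) => n n_ge.
    by rewrite (ger0_norm (mulr_ge0 (ler0n _ _) (expR_ge0 _))) dV_le.
- move=> k; split.
    apply: (eqo_of_exp_bound k c_gt0 (mulr_ge0 B_ge0 (ler0n _ d))) => n n_gt0.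
    apply: le_trans (dE_le n n_gt0) _; rewrite ler_wpM2r ?expR_ge0 //.
    by rewrite ler_peMr ?mulr_ge0 // ler1n.
  apply: (eqo_of_exp_bound k c_gt0 D_ge0) => n n_gt0.
  by rewrite -mulrA dV_le.
Qed.
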